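(* Let $0\to V\to\widehat{\mathfrak p}\xrightarrow{p}\mathfrak p\to0$ be an abelian extension of crossed modules over Leibniz algebras, with $V=(V_1,V_0,\varphi)$, $\mathfrak p=(\mathfrak p_1,\mathfrak p_0,f)$, $\widehat{\mathfrak p}=(\widehat{\mathfrak p}_1,\widehat{\mathfrak p}_0,\widehat f)$, and a fixed section $\sigma=(\sigma_0,\sigma_1)$; let $(\beta,\alpha)\in\mathrm{Der}(V)\times\mathrm{Der}(\mathfrak p)$. Then $(\beta,\alpha)$ is inducible if and only if there exist linear maps $\lambda_0:\mathfrak p_0\to V_0$ and $\lambda_1:\mathfrak p_1\to V_1$ such that for all $x,y\in\mathfrak p_0$, $a\in\mathfrak p_1$, $v\in V_0$, $m\in V_1$: \begin{align*} &\beta_0(\theta(a))-\theta(\alpha_1(a))=\varphi(\lambda_1(a))-\lambda_0(f(a)),\\ &\beta_0(\omega(x,y))-\omega(\alpha_0(x),y)-\omega(x,\alpha_0(y))=l_0(x)(\lambda_0(y))+r_0(y)(\lambda_0(x))-\lambda_0[x,y],\\ &\beta_1(\mu(x,a))-\mu(\alpha_0(x),a)-\mu(x,\alpha_1(a))=l_0(x)(\lambda_1(a))+r_1(a)(\lambda_0(x))-\lambda_1[x,a],\\ &\beta_1(\nu(a,x))-\nu(\alpha_1(a),x)-\nu(a,\alpha_0(x))=r_0(x)(\lambda_1(a))+l_1(a)(\lambda_0(x))-\lambda_1[a,x],\\ &\beta_0l_0(x)(v)-l_0(\alpha_0(x))(v)-l_0(x)(\beta_0(v))=0,\qquad \beta_0r_0(x)(v)-r_0(\alpha_0(x))(v)-r_0(x)(\beta_0(v))=0,\\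 &\beta_1l_0(x)(m)-l_0(\alpha_0(x))(m)-l_0(x)(\beta_1(m))=0,\qquad \beta_1r_0(x)(m)-r_0(\alpha_0(x))(m)-r_0(x)(\beta_1(m))=0,\\ &\beta_1l_1(a)(v)-l_1(\alpha_1(a))(v)-l_1(a)(\beta_0(v))=0,\qquad \beta_1r_1(a)(v)-r_1(\alpha_1(a))(v)-r_1(a)(\beta_0(v))=0. \end{align*}
   Context: All vector spaces are over a fixed field. A Leibniz algebra is a vector space with a bilinear bracket satisfying $[x,[y,z]]=[[x,y],z]+[y,[x,z]]$. A representation of a Leibniz algebra $\mathfrak p_0$ is a vector space $M$ with bilinear maps $\mathfrak p_0\otimes M\to M$, $M\otimes\mathfrak p_0\to M$ (both written $\cdot$) with $[x,y]\cdot m=x\cdot(y\cdot m)-y\cdot(x\cdot m)$; $m\cdot[x,y]=(m\cdot x)\cdot y+x\cdot(m\cdot y)$; $m\cdot[x,y]=x\cdot(m\cdot y)-(x\cdot m)\cdot y$. A crossed module over Leibniz algebra is a triple $(\mathfrak p_1,\mathfrak p_0,f)$ with $\mathfrak p_0$ a Leibniz algebra, $\mathfrak p_1$ a representation of $\mathfrak p_0$, and $f:\mathfrak p_1\to\mathfrak p_0$ linear with $f(x\cdot a)=[x,f(a)]$, $f(a\cdot x)=[f(a),x]$ and $f(a)\cdot b=a\cdot f(b)$. Write $[x,a]=x\cdot a$, $[a,x]=a\cdot x$. A homomorphism $F=(F_0,F_1)$ consists of linear maps $F_i:\mathfrak p_i\to\mathfrak p_i'$ with $F_0f=f'F_1$,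 $F_0[x,y]=[F_0x,F_0y]'$, $F_1[x,a]=[F_0x,F_1a]'$, $F_1[a,x]=[F_1a,F_0x]'$. A derivation $D=(D_0,D_1)$ of $(\mathfrak p_1,\mathfrak p_0,f)$ consists of linear maps $D_i:\mathfrak p_i\to\mathfrak p_i$ with $D_0f=fD_1$, $D_0[x,y]=[D_0x,y]+[x,D_0y]$, $D_1[x,a]=[D_0x,a]+[x,D_1a]$, $D_1[a,x]=[D_1a,x]+[a,D_0x]$. An extension of $(\mathfrak p_1,\mathfrak p_0,f)$ by $(V_1,V_0,\varphi)$ is a sequence $0\to V\to\widehat{\mathfrak p}\xrightarrow{p}\mathfrak p\to0$ of crossed modules and homomorphisms, short exact in each degree ($V\to\widehat{\mathfrak p}$ regarded as an inclusion). It is abelian if the bracket on $V_0$ is zero and the actions of $V_0$ on $V_1$ are zero. A section is a pair of linear maps $\sigma_i:\mathfrak p_i\to\widehat{\mathfrak p}_i$ with $p_i\sigma_i=\mathrm{id}$. For $x,y\in\mathfrak p_0$, $a\in\mathfrak p_1$, $w\in V_0$, $m\in V_1$: $l_0(x)(w+m)=[\sigma_0x,w+m]$, $r_0(x)(w+m)=[w+m,\sigma_0x]$, $l_1(a)(w)=[\sigma_1a,w]$, $r_1(a)(w)=[w,\sigma_1a]$; and $\theta(a)=\widehat f\sigma_1(a)-\sigma_0(f(a))\in V_0$, $\omega(x,y)=[\sigma_0x,\sigma_0y]-\sigma_0[x,y]\in V_0$, $\mu(x,a)=[\sigma_0x,\sigma_1a]-\sigma_1[x,a]\in V_1$, $\nu(a,x)=[\sigma_1a,\sigma_0x]-\sigma_1[a,x]\in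 V_1$. $\mathrm{Der}(V)$, $\mathrm{Der}(\mathfrak p)$ are the additive groups of derivations. $\mathrm{Der}_V(\widehat{\mathfrak p})$ is the additive group of derivations $D$ of $\widehat{\mathfrak p}$ with $D_0(V_0)\subseteq V_0$, $D_1(V_1)\subseteq V_1$; put $D|_V=(D_0|_{V_0},D_1|_{V_1})$, $\overline D=(p_0D_0\sigma_0,p_1D_1\sigma_1)$. A pair $(\beta,\alpha)$, $\beta=(\beta_0,\beta_1)$, $\alpha=(\alpha_0,\alpha_1)$, is inducible if there is $D\in\mathrm{Der}_V(\widehat{\mathfrak p})$ with $D|_V=\beta$ and $\overline D=\alpha$. *)

(* Defs.v *)
From mathcomp Require Import all_boot all_order all_algebra.

Set Implicit Arguments.
Unset Strict Implicit.
Unset Printing Implicit Defensive.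

Import GRing.Theory.
Local Open Scope ring_scope.

(* Vector spaces are lmodTypes over a field, of arbitrary dimension. *)

Record leibniz (K : fieldType) := Leibniz {
  leib_sort :> lmodType K;
  brk : {bilinear leib_sort -> leib_sort -> leib_sort};
  leibniz_identity : forall x y z : leib_sort,
    brk x (brk y z) = brk (brk x y) z + brk y (brk x z)
}.

(* [lact x m] is x . m and [ract m x] is m . x *)
Record leibniz_rep (K : fieldType) (L : leibniz K) := LeibnizRep {
  rep_sort :> lmodType K;
  lact : {bilinear L -> rep_sort -> rep_sort};
  ract : {bilinear rep_sort -> L -> rep_sort};
  rep_axiom1 : forall (x y : L) (m : rep_sort),
    lact (brk L x y) m = lact x (lact y m) - lact y (lact x m);
  rep_axiom2 : forall (x y : L) (m : rep_sort),
    ract m (brk L x y) = ract (ract m x) y + lact x (ract m y);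
  rep_axiom3 : forall (x y : L) (m : rep_sort),
    ract m (brk L x y) = lact x (ract m y) - ract (lact x m) y
}.

Record crossed_module (K : fieldType) := CrossedModule {
  cm0 : leibniz K;
  cm1 : leibniz_rep cm0;
  cmf : {linear cm1 -> cm0};
  cmf_lact : forall (x : cm0) (a : cm1), cmf (lact cm1 x a) = brk cm0 x (cmf a);
  cmf_ract : forall (a : cm1) (x : cm0), cmf (ract cm1 a x) = brk cm0 (cmf a) x;
  cm_peiffer : forall a b : cm1, lact cm1 (cmf a) b = ract cm1 a (cmf b)
}.

Record cm_hom (K : fieldType) (P Q : crossed_module K) := CmHom {
  hom0 : {linear cm0 P -> cm0 Q};
  hom1 : {linear cm1 P -> cm1 Q};
  hom_cmf : forall a : cm1 P, hom0 (cmf P a) = cmf Q (hom1 a);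
  hom_brk : forall x y : cm0 P,
    hom0 (brk (cm0 P) x y) = brk (cm0 Q) (hom0 x) (hom0 y);
  hom_lact : forall (x : cm0 P) (a : cm1 P),
    hom1 (lact (cm1 P) x a) = lact (cm1 Q) (hom0 x) (hom1 a);
  hom_ract : forall (a : cm1 P) (x : cm0 P),
    hom1 (ract (cm1 P) a x) = ract (cm1 Q) (hom1 a) (hom0 x)
}.

Record cm_der (K : fieldType) (P : crossed_module K) := CmDer {
  der0 : {linear cm0 P -> cm0 P};
  der1 : {linear cm1 P -> cm1 P};
  der_cmf : forall a : cm1 P, der0 (cmf P a) = cmf P (der1 a);
  der_brk : forall x y : cm0 P,
    der0 (brk (cm0 P) x y) = brk (cm0 P) (der0 x) y + brk (cm0 P) x (der0 y);
  der_lact : forall (x : cm0 P) (a : cm1 P),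
    der1 (lact (cm1 P) x a) = lact (cm1 P) (der0 x) a + lact (cm1 P) x (der1 a);
  der_ract : forall (a : cm1 P) (x : cm0 P),
    der1 (ract (cm1 P) a x) = ract (cm1 P) (der1 a) x + ract (cm1 P) a (der0 x)
}.

(* The inclusion of V in E is an injective homomorphism [ext_i]. *)
Record extension (K : fieldType) (V E P : crossed_module K) := Extension {
  ext_i : cm_hom V E;
  ext_p : cm_hom E P;
  ext_inj0 : injective (hom0 ext_i);
  ext_inj1 : injective (hom1 ext_i);
  ext_exact0 : forall e : cm0 E,
    hom0 ext_p e = 0 <-> exists v : cm0 V, hom0 ext_i v = e;
  ext_exact1 : forall e : cm1 E,
    hom1 ext_p e = 0 <-> exists m : cm1 V, hom1 ext_i m = e;
  ext_surj0 : forall x : cm0 P, exists e : cm0 E, hom0 ext_p e = x;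
  ext_surj1 : forall a : cm1 P, exists e : cm1 E, hom1 ext_p e = a
}.

Definition abelian_extension (K : fieldType) (V E P : crossed_module K)
    (X : extension V E P) : Prop :=
  [/\ forall v w : cm0 V, brk (cm0 V) v w = 0,
      forall (v : cm0 V) (m : cm1 V), lact (cm1 V) v m = 0
    & forall (m : cm1 V) (v : cm0 V), ract (cm1 V) m v = 0].

Record lin_section (K : fieldType) (V E P : crossed_module K)
    (X : extension V E P) := LinSection {
  sec0 : {linear cm0 P -> cm0 E};
  sec1 : {linear cm1 P -> cm1 E};
  sec0K : forall x : cm0 P, hom0 (ext_p X) (sec0 x) = x;
  sec1K : forall a : cm1 P, hom1 (ext_p X) (sec1 a) = a
}.

Section Corestriction.
Context {K : fieldType} {V E P : crossed_module K} (X : extension V E P).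

Local Notation i0 := (hom0 (ext_i X)).
Local Notation i1 := (hom1 (ext_i X)).
Local Notation p0 := (hom0 (ext_p X)).
Local Notation p1 := (hom1 (ext_p X)).

Fact lift0_ex (e : cm0 E) : p0 e = 0 -> exists v : cm0 V, i0 v == e.
Proof. by move/(ext_exact0 X) => [v <-]; exists v. Qed.

Fact lift1_ex (e : cm1 E) : p1 e = 0 -> exists m : cm1 V, i1 m == e.
Proof. by move/(ext_exact1 X) => [m <-]; exists m. Qed.

(* An element of E killed by p, seen as an element of V; see [lift0K]. *)
Definition lift0 (e : cm0 E) (pe : p0 e = 0) : cm0 V := xchoose (lift0_ex pe).
Definition lift1 (e : cm1 E) (pe : p1 e = 0) : cm1 V := xchoose (lift1_ex pe).

Lemma lift0K (e : cm0 E) (pe : p0 e = 0) : i0 (lift0 pe) = e.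
Proof. exact/eqP/(xchooseP (lift0_ex pe)). Qed.

Lemma lift1K (e : cm1 E) (pe : p1 e = 0) : i1 (lift1 pe) = e.
Proof. exact/eqP/(xchooseP (lift1_ex pe)). Qed.

Lemma pi0 (v : cm0 V) : p0 (i0 v) = 0.
Proof. by apply/(ext_exact0 X); exists v. Qed.

Lemma pi1 (m : cm1 V) : p1 (i1 m) = 0.
Proof. by apply/(ext_exact1 X); exists m. Qed.

End Corestriction.

(* In each degree the maps l_0(x), r_0(x) on V_0 + V_1 are split into their
   components: [l00 x], [r00 x] on V_0 and [l01 x], [r01 x] on V_1. *)
Section StructureMaps.
Context {K : fieldType} {V E P : crossed_module K} {X : extension V E P}.
Context (s : lin_section X).

Local Notation i0 := (hom0 (ext_i X)).
Local Notation i1 := (hom1 (ext_i X)).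
Local Notation p0 := (hom0 (ext_p X)).
Local Notation p1 := (hom1 (ext_p X)).
Local Notation s0 := (sec0 s).
Local Notation s1 := (sec1 s).

Fact l00_ker x v : p0 (brk (cm0 E) (s0 x) (i0 v)) = 0.
Proof. by rewrite hom_brk pi0 linear0r. Qed.
Definition l00 (x : cm0 P) (v : cm0 V) : cm0 V := lift0 (l00_ker x v).

Fact r00_ker x v : p0 (brk (cm0 E) (i0 v) (s0 x)) = 0.
Proof. by rewrite hom_brk pi0 linear0l. Qed.
Definition r00 (x : cm0 P) (v : cm0 V) : cm0 V := lift0 (r00_ker x v).

Fact l01_ker x m : p1 (lact (cm1 E) (s0 x) (i1 m)) = 0.
Proof. by rewrite hom_lact pi1 linear0r. Qed.
Definition l01 (x : cm0 P) (m : cm1 V) : cm1 V := lift1 (l01_ker x m).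

Fact r01_ker x m : p1 (ract (cm1 E) (i1 m) (s0 x)) = 0.
Proof. by rewrite hom_ract pi1 linear0l. Qed.
Definition r01 (x : cm0 P) (m : cm1 V) : cm1 V := lift1 (r01_ker x m).

Fact l1_ker a v : p1 (ract (cm1 E) (s1 a) (i0 v)) = 0.
Proof. by rewrite hom_ract pi0 linear0r. Qed.
Definition l1 (a : cm1 P) (v : cm0 V) : cm1 V := lift1 (l1_ker a v).

Fact r1_ker a v : p1 (lact (cm1 E) (i0 v) (s1 a)) = 0.
Proof. by rewrite hom_lact pi0 linear0l. Qed.
Definition r1 (a : cm1 P) (v : cm0 V) : cm1 V := lift1 (r1_ker a v).

Fact theta_ker a : p0 (cmf E (s1 a) - s0 (cmf P a)) = 0.
Proof. by rewrite linearB /= hom_cmf sec1K sec0K subrr. Qed.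
Definition theta (a : cm1 P) : cm0 V := lift0 (theta_ker a).

Fact omega_ker x y :
  p0 (brk (cm0 E) (s0 x) (s0 y) - s0 (brk (cm0 P) x y)) = 0.
Proof. by rewrite linearB /= hom_brk !sec0K subrr. Qed.
Definition omega (x y : cm0 P) : cm0 V := lift0 (omega_ker x y).

Fact mu_ker x a : p1 (lact (cm1 E) (s0 x) (s1 a) - s1 (lact (cm1 P) x a)) = 0.
Proof. by rewrite linearB /= hom_lact !(sec0K, sec1K) subrr. Qed.
Definition mu (x : cm0 P) (a : cm1 P) : cm1 V := lift1 (mu_ker x a).

Fact nu_ker a x : p1 (ract (cm1 E) (s1 a) (s0 x) - s1 (ract (cm1 P) a x)) = 0.
Proof. by rewrite linearB /= hom_ract !(sec0K, sec1K) subrr. Qed.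
Definition nu (a : cm1 P) (x : cm0 P) : cm1 V := lift1 (nu_ker a x).

End StructureMaps.

Record stable_der (K : fieldType) (V E P : crossed_module K)
    (X : extension V E P) := StableDer {
  sder :> cm_der E;
  sder0 : forall v : cm0 V,
    exists w : cm0 V, hom0 (ext_i X) w = der0 sder (hom0 (ext_i X) v);
  sder1 : forall m : cm1 V,
    exists n : cm1 V, hom1 (ext_i X) n = der1 sder (hom1 (ext_i X) m)
}.

Section Inducible.
Context {K : fieldType} {V E P : crossed_module K} {X : extension V E P}.

Fact der_res0_ker (D : stable_der X) v :
  hom0 (ext_p X) (der0 D (hom0 (ext_i X) v)) = 0.
Proof. by apply/(ext_exact0 X)/sder0. Qed.
Definition der_res0 (D : stable_der X) (v : cm0 V) : cm0 V :=
  lift0 (der_res0_ker D v).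

Fact der_res1_ker (D : stable_der X) m :
  hom1 (ext_p X) (der1 D (hom1 (ext_i X) m)) = 0.
Proof. by apply/(ext_exact1 X)/sder1. Qed.
Definition der_res1 (D : stable_der X) (m : cm1 V) : cm1 V :=
  lift1 (der_res1_ker D m).

Definition der_bar0 (s : lin_section X) (D : stable_der X) (x : cm0 P) : cm0 P :=
  hom0 (ext_p X) (der0 D (sec0 s x)).
Definition der_bar1 (s : lin_section X) (D : stable_der X) (a : cm1 P) : cm1 P :=
  hom1 (ext_p X) (der1 D (sec1 s a)).

Definition inducible (s : lin_section X) (beta : cm_der V) (alpha : cm_der P) :
    Prop :=
  exists D : stable_der X,
    [/\ der_res0 D =1 der0 beta, der_res1 D =1 der1 beta,
        der_bar0 s D =1 der0 alpha & der_bar1 s D =1 der1 alpha].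

End Inducible.

(* Main.v *)
(** Split E as s(P) + i(V). A linear endomorphism D preserving V and inducing
    beta on V and alpha on P is the same as a linear lambda : P -> V, through
    D (s x) = s (alpha x) + i (lambda x) and D (i v) = i (beta v). Each of the
    brackets [x,y], [x,a], [a,x] of E is a bilinear map, determined by its values
    on s(P) and i(V); the Leibniz rule for D on the pairs (s, s), (s, i), (i, s)
    is then respectively the cocycle equation in lambda and the two equations
    that do not involve lambda, and it is trivial on (i, i) because V is
    abelian. *)
From HB Require Import structures.
Require Import Defs.
From mathcomp Require Import all_boot all_order all_algebra.

Set Implicit Arguments.
Unset Strict Implicit.
Unset Printing Implicit Defensive.

Import GRing.Theory.
Local Open Scope ring_scope.

(** * Linear algebra of a split short exact sequence *)

Lemma linear_factor_injective (K : fieldType) (A B C : lmodType K)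
    (i : {linear A -> B}) (g : {linear C -> B}) :
  injective i -> (forall x, exists a, i a = g x) ->
  exists h : {linear C -> A}, forall x, i (h x) = g x.
Proof.
move=> inji im_g.
have ex_h x : exists a, i a == g x by have [a <-] := im_g x; exists a.
pose h x := xchoose (ex_h x).
have hE x : i (h x) = g x by apply/eqP/(xchooseP (ex_h x)).
(* Preimages under the injective [i] are unique, so linearity of the chosen [h] can be tested after
   applying [i], where it is linearity of [g]. *)
have lin_h : linear h by move=> k x y; apply: inji; rewrite linearP !hE linearP.
pose H := GRing.isLinear.Build K C A _ h lin_h.
pose hl : {linear C -> A} := HB.pack h H.
by exists hl.
Qed.

Section BlockTriangular.
Context (K : fieldType) (V E P : lmodType K).
Context (i : {linear V -> E}) (s : {linear P -> E}).

(** Existence of the decomposition suffices: it is used to check identities between additive maps,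
    one summand at a time. *)
Definition split_sum := forall e, exists x v, e = s x + i v.

Definition block_triangular (alpha : P -> P) (beta : V -> V) (lambda : P -> V)
    (D : E -> E) :=
  (forall x, D (s x) = s (alpha x) + i (lambda x)) /\
  (forall v, D (i v) = i (beta v)).

Context (p : {linear E -> P}).
Context (exact_ip : forall e, p e = 0 <-> exists v, i v = e).
Context (sK : forall x, p (s x) = x).

Lemma exact_split_sum : split_sum.
Proof.
move=> e; exists (p e).
have [v iv] : exists v, i v = e - s (p e).
  by apply/exact_ip; rewrite linearB /= sK subrr.
by exists v; rewrite iv addrC subrK.
Qed.

Context (inji : injective i).

Lemma block_triangular_ex (alpha : {linear P -> P}) (beta : {linear V -> V})
    (lambda : {linear P -> V}) :
  exists D : {linear E -> E}, block_triangular alpha beta lambda D.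
Proof.
have pi0 v : p (i v) = 0 by apply/exact_ip; exists v.
(* [g] is the projection onto [i(V)] along [s(P)]. Its image lies in the kernel of [p], so it
   factors as [i \o q], and [q] reads off the [V]-component. *)
pose g : {linear E -> E} := idfun \- (s \o p).
have [|q qE] := linear_factor_injective (g := g) inji.
  by move=> e; apply/exact_ip; rewrite linearB /= sK subrr.
have qs x : q (s x) = 0 by apply: inji; rewrite qE /= sK subrr linear0.
have qi v : q (i v) = v by apply: inji; rewrite qE /= pi0 linear0 subr0.
(* One summand for each nonzero block: [P] to [P], [P] to [V], and [V] to [V]. *)
pose D : {linear E -> E} :=
  (s \o alpha \o p) \+ (i \o lambda \o p) \+ (i \o beta \o q).
exists D; split=> [x|v] /=.
  by rewrite sK qs !linear0 addr0.
by rewrite pi0 qi !linear0 !add0r.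
Qed.

(** The difference [D \o s - s \o alpha] is killed by [p], hence factors through [i]; the factor is
    [lambda]. *)
Lemma block_triangularP (alpha : {linear P -> P}) (beta : V -> V)
    (D : {linear E -> E}) :
  (forall v, D (i v) = i (beta v)) -> (forall x, p (D (s x)) = alpha x) ->
  exists lambda : {linear P -> V}, block_triangular alpha beta lambda D.
Proof.
move=> Di Ds.
pose g : {linear P -> E} := (D \o s) \- (s \o alpha).
have [|lambda lambdaE] := linear_factor_injective (g := g) inji.
  by move=> x; apply/exact_ip; rewrite linearB /= sK Ds subrr.
by exists lambda; split=> // x; rewrite lambdaE /= addrC subrK.
Qed.

End BlockTriangular.

(** * The Leibniz rule for a bilinear map between split spaces *)

Definition leibniz_rule (K : fieldType) (E1 E2 E3 : lmodType K)
    (b : E1 -> E2 -> E3) (D1 : E1 -> E1) (D2 : E2 -> E2) (D3 : E3 -> E3) :=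
  forall x y, D3 (b x y) = b (D1 x) y + b x (D2 y).

Section LeibnizRule.
Context (K : fieldType) (V1 E1 P1 V2 E2 P2 V3 E3 P3 : lmodType K).
Context (i1 : {linear V1 -> E1}) (s1 : {linear P1 -> E1}).
Context (i2 : {linear V2 -> E2}) (s2 : {linear P2 -> E2}).
Context (i3 : {linear V3 -> E3}) (s3 : {linear P3 -> E3}).
Context (b : {bilinear E1 -> E2 -> E3}) (bP : P1 -> P2 -> P3).
Context (omega : P1 -> P2 -> V3) (l : P1 -> V2 -> V3) (r : P2 -> V1 -> V3).
Context (alpha1 : P1 -> P1) (beta1 : V1 -> V1) (lambda1 : P1 -> V1).
Context (alpha2 : P2 -> P2) (beta2 : V2 -> V2) (lambda2 : P2 -> V2).
Context (alpha3 : P3 -> P3) (beta3 : V3 -> V3) (lambda3 : P3 -> V3).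
Context (D1 : {linear E1 -> E1}) (D2 : {linear E2 -> E2}) (D3 : {linear E3 -> E3}).

Context (inj3 : injective i3).
Context (split1 : split_sum i1 s1).
Context (split2 : split_sum i2 s2).
Context (b_ii : forall v w, b (i1 v) (i2 w) = 0).
Context (omegaE : forall x y, i3 (omega x y) = b (s1 x) (s2 y) - s3 (bP x y)).
Context (lE : forall x w, i3 (l x w) = b (s1 x) (i2 w)).
Context (rE : forall y v, i3 (r y v) = b (i1 v) (s2 y)).
Context (alpha_rule : leibniz_rule bP alpha1 alpha2 alpha3).
Context (D1E : block_triangular i1 s1 alpha1 beta1 lambda1 D1).
Context (D2E : block_triangular i2 s2 alpha2 beta2 lambda2 D2).
Context (D3E : block_triangular i3 s3 alpha3 beta3 lambda3 D3).

Let rule_at e e' := D3 (b e e') = b (D1 e) e' + b e (D2 e').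

(** Products of lifts split as [i3 (omega u w) + s3 (bP u w)]. The [s3]-parts of both sides agree by
    [alpha_rule]; cancelling them and then [i3] leaves an equation in [V3]. *)
Let rule_at_ss x y : rule_at (s1 x) (s2 y) <->
  beta3 (omega x y) - omega (alpha1 x) y - omega x (alpha2 y)
    = l x (lambda2 y) + r y (lambda1 x) - lambda3 (bP x y).
Proof.
have [D1s _] := D1E; have [D2s _] := D2E; have [D3s D3i] := D3E.
rewrite /rule_at D1s D2s linearDl linearDr /= -rE -lE.
have bE u w : b (s1 u) (s2 w) = i3 (omega u w) + s3 (bP u w).
  by rewrite omegaE subrK.
rewrite !bE linearD D3i D3s alpha_rule linearD /=.
set S := s3 _; set S' := s3 _.
(* The right-hand side of the rule, regrouped into its [i3]-part and its [s3]-part [S + S']. *)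
have <- : i3 (l x (lambda2 y) + r y (lambda1 x)
              + (omega (alpha1 x) y + omega x (alpha2 y))) + (S + S')
    = i3 (omega (alpha1 x) y) + S + i3 (r y (lambda1 x))
      + (i3 (omega x (alpha2 y)) + S' + i3 (l x (lambda2 y))).
  by rewrite !linearD /= [RHS](AC (3*3) ((6*3)*(1*4)*(2*5)))%AC /=.
rewrite [S + S' + _]addrC addrA -linearD.
rewrite -[beta3 _ - _ - _]addrA -opprD.
split=> [/addIr/inj3 h|/eqP].
  by apply/eqP; rewrite subr_eq addrAC eq_sym subr_eq eq_sym h.
by rewrite subr_eq addrAC eq_sym subr_eq => /eqP ->.
Qed.

(** The off-diagonal term [b (i1 (lambda1 x)) (i2 w)] vanishes by [b_ii], so [lambda1] leaves no
    trace; [rule_at_is] is symmetric. *)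
Let rule_at_si x w : rule_at (s1 x) (i2 w) <->
  beta3 (l x w) - l (alpha1 x) w - l x (beta2 w) = 0.
Proof.
have [D1s _] := D1E; have [_ D2i] := D2E; have [_ D3i] := D3E.
rewrite /rule_at D1s D2i linearDl /= b_ii addr0 -!lE D3i -linearD.
rewrite -[beta3 _ - _ - _]addrA -opprD; split=> [/inj3 ->|/subr0_eq -> //].
by rewrite subrr.
Qed.

Let rule_at_is v y : rule_at (i1 v) (s2 y) <->
  beta3 (r y v) - r (alpha2 y) v - r y (beta1 v) = 0.
Proof.
have [_ D1i] := D1E; have [D2s _] := D2E; have [_ D3i] := D3E.
rewrite /rule_at D1i D2s linearDr /= b_ii addr0 -!rE D3i -linearD addrC.
rewrite -[beta3 _ - _ - _]addrA -opprD; split=> [/inj3 ->|/subr0_eq -> //].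
by rewrite subrr.
Qed.

(** Three independent splittings are allowed so that the bracket, which stays in degree 0, and the
    two actions, which mix degrees 0 and 1, are all instances. *)
Lemma leibniz_rule_block_triangular :
  leibniz_rule b D1 D2 D3 <->
  [/\ forall x y, beta3 (omega x y) - omega (alpha1 x) y - omega x (alpha2 y)
        = l x (lambda2 y) + r y (lambda1 x) - lambda3 (bP x y),
      forall x w, beta3 (l x w) - l (alpha1 x) w - l x (beta2 w) = 0
    & forall y v, beta3 (r y v) - r (alpha2 y) v - r y (beta1 v) = 0].
Proof.
split=> [rule | [ss si is_] e e'].
  by split=> *; [apply/rule_at_ss | apply/rule_at_si | apply/rule_at_is];
    apply: rule.
have [x [v ->]] := split1 e; have [y [w ->]] := split2 e'.
have [_ D1i] := D1E; have [_ D2i] := D2E.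
move/rule_at_ss: (ss x y) => ssE; move/rule_at_si: (si x w) => siE.
move/rule_at_is: (is_ y v) => isE.
have iiE : rule_at (i1 v) (i2 w) by rewrite /rule_at D1i D2i !b_ii linear0 addr0.
rewrite (linearD D1) (linearD D2) !linearDl !linearDr !(linearD D3) /=.
(* Each of the four pairs contributes a [D1] term followed by a [D2] term; [AC] collects the four
   [D1] terms (odd positions), then the four [D2] terms. *)
by rewrite ssE siE isE iiE (AC ((2*2)*(2*2)) (((1*3)*(5*7))*((2*4)*(6*8))))%AC.
Qed.

End LeibnizRule.

(** * Derivations of an abelian extension *)

Section AbelianExtension.
Context (K : fieldType) (V E P : crossed_module K).
Context (X : extension V E P) (hX : abelian_extension X) (s : lin_section X).
Context (beta : cm_der V) (alpha : cm_der P).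

Local Notation i0 := (hom0 (ext_i X)).
Local Notation i1 := (hom1 (ext_i X)).
Local Notation s0 := (sec0 s).
Local Notation s1 := (sec1 s).

(** On [i(V)] the compatibility is automatic, since [beta] commutes with [cmf V]. On [s(P)], where
    [cmf E (s1 a)] is [i0 (theta s a) + s0 (cmf P a)], the [s0]-parts cancel because [alpha]
    commutes with [cmf P], and the [i0]-parts give the equation for [theta]. *)
Lemma cmf_block_triangular (lambda0 : cm0 P -> cm0 V) (lambda1 : cm1 P -> cm1 V)
    (D0 : {linear cm0 E -> cm0 E}) (D1 : {linear cm1 E -> cm1 E}) :
  block_triangular i0 s0 (der0 alpha) (der0 beta) lambda0 D0 ->
  block_triangular i1 s1 (der1 alpha) (der1 beta) lambda1 D1 ->
  (forall e, D0 (cmf E e) = cmf E (D1 e)) <->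
  (forall a, der0 beta (theta s a) - theta s (der1 alpha a)
     = cmf V (lambda1 a) - lambda0 (cmf P a)).
Proof.
move=> [D0s D0i] [D1s D1i].
have fs a : cmf E (s1 a) = i0 (theta s a) + s0 (cmf P a).
  by rewrite lift0K subrK.
have at_s a : D0 (cmf E (s1 a)) = cmf E (D1 (s1 a)) <->
    der0 beta (theta s a) - theta s (der1 alpha a)
      = cmf V (lambda1 a) - lambda0 (cmf P a).
  rewrite D1s fs !linearD /= fs D0i D0s der_cmf -hom_cmf.
  set S := s0 _; rewrite [S + _]addrC addrA [RHS]addrAC -!linearD.
  split=> [/addIr/(@ext_inj0 _ _ _ _ X) h|/eqP].
    by apply/eqP; rewrite subr_eq addrAC eq_sym subr_eq eq_sym h addrC.
  by rewrite subr_eq addrAC eq_sym subr_eq addrC => /eqP ->.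
split=> [h a|h e]; first exact/at_s/h.
have [a [m ->]] := exact_split_sum (ext_exact1 X) (sec1K s) e.
by rewrite !linearD /= -hom_cmf D0i D1i -hom_cmf der_cmf (at_s a).2.
Qed.

Definition inducibility_equations (lambda0 : cm0 P -> cm0 V)
    (lambda1 : cm1 P -> cm1 V) :=
  forall (x y : cm0 P) (a : cm1 P) (v : cm0 V) (m : cm1 V),
    (der0 beta (theta s a) - theta s (der1 alpha a)
       = cmf V (lambda1 a) - lambda0 (cmf P a))
    /\ (der0 beta (omega s x y)
          - omega s (der0 alpha x) y - omega s x (der0 alpha y)
        = l00 s x (lambda0 y) + r00 s y (lambda0 x)
          - lambda0 (brk (cm0 P) x y))
    /\ (der1 beta (mu s x a) - mu s (der0 alpha x) a - mu s x (der1 alpha a)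
        = l01 s x (lambda1 a) + r1 s a (lambda0 x)
          - lambda1 (lact (cm1 P) x a))
    /\ (der1 beta (nu s a x) - nu s (der1 alpha a) x - nu s a (der0 alpha x)
        = r01 s x (lambda1 a) + l1 s a (lambda0 x)
          - lambda1 (ract (cm1 P) a x))
    /\ (der0 beta (l00 s x v) - l00 s (der0 alpha x) v - l00 s x (der0 beta v)
        = 0)
    /\ (der0 beta (r00 s x v) - r00 s (der0 alpha x) v - r00 s x (der0 beta v)
        = 0)
    /\ (der1 beta (l01 s x m) - l01 s (der0 alpha x) m - l01 s x (der1 beta m)
        = 0)
    /\ (der1 beta (r01 s x m) - r01 s (der0 alpha x) m - r01 s x (der1 beta m)
        = 0)
    /\ (der1 beta (l1 s a v) - l1 s (der1 alpha a) v - l1 s a (der0 beta v)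
        = 0)
    /\ (der1 beta (r1 s a v) - r1 s (der1 alpha a) v - r1 s a (der0 beta v)
        = 0).

(** The bracket, left action and right action instantiate [leibniz_rule_block_triangular] with
    cocycles [omega], [mu] and [nu]. Abelianness supplies the vanishing of products of two elements
    of [V] in all three cases. *)
Lemma derivation_block_triangular
    (lambda0 : cm0 P -> cm0 V) (lambda1 : cm1 P -> cm1 V)
    (D0 : {linear cm0 E -> cm0 E}) (D1 : {linear cm1 E -> cm1 E}) :
  block_triangular i0 s0 (der0 alpha) (der0 beta) lambda0 D0 ->
  block_triangular i1 s1 (der1 alpha) (der1 beta) lambda1 D1 ->
  [/\ forall e, D0 (cmf E e) = cmf E (D1 e),
      leibniz_rule (brk (cm0 E)) D0 D0 D0,
      leibniz_rule (lact (cm1 E)) D0 D1 D1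
    & leibniz_rule (ract (cm1 E)) D1 D0 D1] <->
  inducibility_equations lambda0 lambda1.
Proof.
move=> D0E D1E; have [brkV lactV ractV] := hX.
have split0 := exact_split_sum (ext_exact0 X) (sec0K s).
have split1 := exact_split_sum (ext_exact1 X) (sec1K s).
have brk_ii v w : brk (cm0 E) (i0 v) (i0 w) = 0.
  by rewrite -hom_brk brkV linear0.
have lact_ii v m : lact (cm1 E) (i0 v) (i1 m) = 0.
  by rewrite -hom_lact lactV linear0.
have ract_ii m v : ract (cm1 E) (i1 m) (i0 v) = 0.
  by rewrite -hom_ract ractV linear0.
have fE := cmf_block_triangular D0E D1E.
have brkE := leibniz_rule_block_triangular (b := brk (cm0 E))
  (bP := brk (cm0 P)) (omega := omega s) (l := l00 s) (r := r00 s)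
  (@ext_inj0 _ _ _ _ X) split0 split0
  brk_ii
  (fun _ _ => lift0K _) (fun _ _ => lift0K _) (fun _ _ => lift0K _)
  (der_brk alpha) D0E D0E D0E.
have lactE := leibniz_rule_block_triangular (b := lact (cm1 E))
  (bP := lact (cm1 P)) (omega := mu s) (l := l01 s) (r := r1 s)
  (@ext_inj1 _ _ _ _ X) split0 split1
  lact_ii
  (fun _ _ => lift1K _) (fun _ _ => lift1K _) (fun _ _ => lift1K _)
  (der_lact alpha) D0E D1E D1E.
have ractE := leibniz_rule_block_triangular (b := ract (cm1 E))
  (bP := ract (cm1 P)) (omega := nu s) (l := l1 s) (r := r01 s)
  (@ext_inj1 _ _ _ _ X) split1 split0
  ract_ii
  (fun _ _ => lift1K _) (fun _ _ => lift1K _) (fun _ _ => lift1K _)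
  (der_ract alpha) D1E D0E D1E.
split.
  move=> [/fE ft /brkE[bss bsi bis] /lactE[lss lsi lis] /ractE[rss rsi ris]].
  (* The general cocycle equation puts the [l] term first, which for the right action is [l1]; the
     equation for [nu] starts with [r01]. *)
  by move=> x y a v m; do !apply: conj; rewrite ?[r01 _ _ _ + _]addrC.
(* The ten equations share one quantifier, so each is extracted by putting 0 for the variables that
   do not occur in it. *)
move=> eqs; split.
- by apply/fE => a; case: (eqs 0 0 a 0 0).
- apply/brkE; split=> [x y|x v|y v];
    [case: (eqs x y 0 0 0) | case: (eqs x 0 0 v 0) | case: (eqs y 0 0 v 0)]; tauto.
- apply/lactE; split=> [x a|x m|a v];
    [case: (eqs x 0 a 0 0) | case: (eqs x 0 0 0 m) | case: (eqs 0 0 a v 0)]; tauto.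
- apply/ractE; split=> [a x|a v|x m]; first rewrite [l1 _ _ _ + _]addrC;
    [case: (eqs x 0 a 0 0) | case: (eqs 0 0 a v 0) | case: (eqs x 0 0 0 m)]; tauto.
Qed.

(** From an inducing derivation, [block_triangularP] extracts the two [lambda] maps; conversely
    [block_triangular_ex] builds [D0] and [D1] from them. In both directions
    [derivation_block_triangular] translates the conditions. *)
Lemma inducible_iff_equations :
  inducible s beta alpha <->
  exists (lambda0 : {linear cm0 P -> cm0 V}) (lambda1 : {linear cm1 P -> cm1 V}),
    inducibility_equations lambda0 lambda1.
Proof.
split=> [[D [Dv Dm Dx Da]] | [lambda0 [lambda1 eqs]]].
  have D0i v : der0 D (i0 v) = i0 (der0 beta v) by rewrite -Dv lift0K.
  have D1i m : der1 D (i1 m) = i1 (der1 beta m) by rewrite -Dm lift1K.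
  have [lambda0 D0E] :=
    block_triangularP (ext_exact0 X) (sec0K s) (@ext_inj0 _ _ _ _ X) D0i Dx.
  have [lambda1 D1E] :=
    block_triangularP (ext_exact1 X) (sec1K s) (@ext_inj1 _ _ _ _ X) D1i Da.
  exists lambda0, lambda1; apply/(derivation_block_triangular D0E D1E).
  split; [exact: der_cmf | exact: der_brk | exact: der_lact | exact: der_ract].
have [D0 D0E] := block_triangular_ex (ext_exact0 X) (sec0K s) (@ext_inj0 _ _ _ _ X)
  (der0 alpha) (der0 beta) lambda0.
have [D1 D1E] := block_triangular_ex (ext_exact1 X) (sec1K s) (@ext_inj1 _ _ _ _ X)
  (der1 alpha) (der1 beta) lambda1.
have /(derivation_block_triangular D0E D1E)[Df Db Dl Dr] := eqs.
have [[D0s D0i] [D1s D1i]] := (D0E, D1E).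
(* Stability of [V] is witnessed by [beta] itself. *)
have st0 v : exists w, i0 w = D0 (i0 v) by exists (der0 beta v); rewrite D0i.
have st1 m : exists n, i1 n = D1 (i1 m) by exists (der1 beta m); rewrite D1i.
exists (@StableDer _ _ _ _ X (CmDer Df Db Dl Dr) st0 st1).
split=> [v|m|x|a].
- by apply: (@ext_inj0 _ _ _ _ X); rewrite lift0K /= D0i.
- by apply: (@ext_inj1 _ _ _ _ X); rewrite lift1K /= D1i.
(* The [lambda0] component lies in [i(V)] and is killed by the projection, so only [alpha]
   survives. *)
- by rewrite /der_bar0 /= D0s linearD /= sec0K pi0 addr0.
- by rewrite /der_bar1 /= D1s linearD /= sec1K pi1 addr0.
Qed.

End AbelianExtension.

Theorem theorem5p11 (K : fieldType) (V E P : crossed_module K)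
    (X : extension V E P) (hX : abelian_extension X) (s : lin_section X)
    (beta : cm_der V) (alpha : cm_der P) :
  inducible s beta alpha <->
  exists (lambda0 : {linear cm0 P -> cm0 V}) (lambda1 : {linear cm1 P -> cm1 V}),
    forall (x y : cm0 P) (a : cm1 P) (v : cm0 V) (m : cm1 V),
    (der0 beta (theta s a) - theta s (der1 alpha a)
       = cmf V (lambda1 a) - lambda0 (cmf P a))
    /\ (der0 beta (omega s x y)
          - omega s (der0 alpha x) y - omega s x (der0 alpha y)
        = l00 s x (lambda0 y) + r00 s y (lambda0 x)
          - lambda0 (brk (cm0 P) x y))
    /\ (der1 beta (mu s x a) - mu s (der0 alpha x) a - mu s x (der1 alpha a)
        = l01 s x (lambda1 a) + r1 s a (lambda0 x)
          - lambda1 (lact (cm1 P) x a))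
    /\ (der1 beta (nu s a x) - nu s (der1 alpha a) x - nu s a (der0 alpha x)
        = r01 s x (lambda1 a) + l1 s a (lambda0 x)
          - lambda1 (ract (cm1 P) a x))
    /\ (der0 beta (l00 s x v) - l00 s (der0 alpha x) v - l00 s x (der0 beta v)
        = 0)
    /\ (der0 beta (r00 s x v) - r00 s (der0 alpha x) v - r00 s x (der0 beta v)
        = 0)
    /\ (der1 beta (l01 s x m) - l01 s (der0 alpha x) m - l01 s x (der1 beta m)
        = 0)
    /\ (der1 beta (r01 s x m) - r01 s (der0 alpha x) m - r01 s x (der1 beta m)
        = 0)
    /\ (der1 beta (l1 s a v) - l1 s (der1 alpha a) v - l1 s a (der0 beta v)
        = 0)
    /\ (der1 beta (r1 s a v) - r1 s (der1 alpha a) v - r1 s a (der0 beta v)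
        = 0).
Proof.
exact: inducible_iff_equations.
Qed.
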